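(* Let $X_0\in\Gamma_1$ and let $(X_n)_{n\ge0}$ be the sequence produced by the iterative proportional fitting procedure started at $X_0$ with target marginals $a,b$. Assume that $\Gamma$ contains some matrix with support included in $\mathrm{Supp}(X_0)$ but contains no matrix with support equal to $\mathrm{Supp}(X_0)$. Then: 1. For all $i\in\{1,\dots,p\}$ and $j\in\{1,\dots,q\}$, the series $\sum_{n\ge0}(R_i(X_{2n})-1)^2$ and $\sum_{n\ge0}(C_j(X_{2n+1})-1)^2$ converge. 2. For all $i,j$, the sequences $(\sqrt n(R_i(X_n)-1))_{n\ge0}$ and $(\sqrt n(C_j(X_n)-1))_{n\ge0}$ converge to $0$. In particular, the sequences $(R_i(X_n))_{n\ge0}$ and $(C_j(X_n))_{n\ge0}$ converge to $1$. 3. The sequence $(X_n)_{n\ge0}$ converges to some matrix $X_\infty$ whose support contains the support of every matrix in $\Gamma(X_0)$. 4. The limit $X_\infty$ is the unique matrix achieving the minimum of $D(Y\|X_0)$ over all $Y\in\Gamma(X_0)$. 5. If $(i,j)\in\mathrm{Supp}(X_0)\setminus\mathrm{Supp}(X_\infty)$, the infinite product $R_i(X_0)C_j(X_1)R_i(X_2)C_j(X_3)\cdots$ is infinite (its partial products tend to $+\infty$).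
   Context: Fix integers $p,q\ge 2$ and vectors $a=(a_1,\dots,a_p)$, $b=(b_1,\dots,b_q)$ with positive components such that $\sum_i a_i=\sum_j b_j=1$. For a $p\times q$ matrix $X$, set $X(i,+)=\sum_jX(i,j)$, $X(+,j)=\sum_iX(i,j)$, $X(+,+)=\sum_{i,j}X(i,j)$, $R_i(X)=X(i,+)/a_i$, $C_j(X)=X(+,j)/b_j$. $\Gamma_0$ is the set of non-negative $p\times q$ matrices all of whose row sums and column sums are positive; $\Gamma_1=\{X\in\Gamma_0:X(+,+)=1\}$; $\Gamma=\Gamma(a,b)$ is the set of $X\in\Gamma_0$ with $X(i,+)=a_i$ for all $i$ and $X(+,j)=b_j$ for all $j$. $\mathrm{Supp}(X)=\{(i,j):X(i,j)>0\}$ and $\Gamma(X_0)=\{S\in\Gamma:\mathrm{Supp}(S)\subset\mathrm{Supp}(X_0)\}$. Iterative proportional fitting procedure (IPFP): for $X\in\Gamma_0$ let $T_R(X)(i,j)=X(i,j)/R_i(X)$ and $T_C(X)(i,j)=X(i,j)/C_j(X)$; then $X_{2n+1}=T_R(X_{2n})$ and $X_{2n+2}=T_C(X_{2n+1})$ for all $n\ge0$. Relative entropy: for $X,Y\in\Gamma_1$, $D(Y\|X)=\sum_{(i,j)\in\mathrm{Supp}(X)}Y(i,j)\ln\frac{Y(i,j)}{X(i,j)}$ if $\mathrm{Supp}(Y)\subset\mathrm{Supp}(X)$ (with $0\ln0=0$), and $D(Y\|X)=+\infty$ otherwise. *)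

(* Defs.v *)
From HB Require Import structures.
From mathcomp Require Import all_boot all_order all_algebra.
From mathcomp Require Import all_classical all_reals all_analysis.

Set Implicit Arguments.
Unset Strict Implicit.
Unset Printing Implicit Defensive.

Import Order.TTheory GRing.Theory Num.Theory.
Import numFieldNormedType.Exports.

Local Open Scope ring_scope.

Section IPFP.
Variables (R : realType) (p q : nat).
Implicit Types (X Y S : 'M[R]_(p, q)) (a : 'rV[R]_p) (b : 'rV[R]_q).

Definition rowsum X (i : 'I_p) : R := \sum_(j < q) X i j.
Definition colsum X (j : 'I_q) : R := \sum_(i < p) X i j.
Definition totsum X : R := \sum_(i < p) \sum_(j < q) X i j.

Definition rowratio a X (i : 'I_p) : R := rowsum X i / a 0 i.
Definition colratio b X (j : 'I_q) : R := colsum X j / b 0 j.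

Definition Supp X : {set 'I_p * 'I_q} := [set ij | 0 < X ij.1 ij.2]%SET.

Definition Gamma0 : set 'M[R]_(p, q) :=
  [set X : 'M[R]_(p, q) | [/\ forall i j, 0 <= X i j,
               forall i, 0 < rowsum X i &
               forall j, 0 < colsum X j]]%classic.

Definition Gamma1 : set 'M[R]_(p, q) :=
  [set X : 'M[R]_(p, q) | Gamma0 X /\ totsum X = 1]%classic.

Definition Gamma a b : set 'M[R]_(p, q) :=
  [set X : 'M[R]_(p, q) | [/\ Gamma0 X,
               forall i, rowsum X i = a 0 i &
               forall j, colsum X j = b 0 j]]%classic.

Definition GammaSub a b X0 : set 'M[R]_(p, q) :=
  [set S : 'M[R]_(p, q) | Gamma a b S /\ Supp S \subset Supp X0]%classic.

Definition TR a X : 'M[R]_(p, q) := \matrix_(i, j) (X i j / rowratio a X i).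
Definition TC b X : 'M[R]_(p, q) := \matrix_(i, j) (X i j / colratio b X j).

Fixpoint ipfp a b X0 (n : nat) : 'M[R]_(p, q) :=
  if n is m.+1 then
    if odd m then TC b (ipfp a b X0 m) else TR a (ipfp a b X0 m)
  else X0.

(* [relent Y X] is D(Y || X); it is only meaningful for Y and X in Gamma1.
   The convention 0 * ln 0 = 0 holds because the factor Y i j vanishes
   and [ln] is total. *)
Definition relent Y X : \bar R :=
  if Supp Y \subset Supp X then
    (\sum_(ij in Supp X)
       Y ij.1 ij.2 * ln (Y ij.1 ij.2 / X ij.1 ij.2))%:E
  else +oo%E.

End IPFP.

(* Main.v *)
Require Import Defs.
From HB Require Import structures.
From mathcomp Require Import all_boot all_order all_algebra.
From mathcomp Require Import all_classical all_reals all_analysis.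
From mathcomp Require Import ring lra zify.

Import Order.TTheory GRing.Theory Num.Theory.
Import numFieldNormedType.Exports.

(** Each step of the procedure is an entropy projection. Write [kl] for relative
entropy and let [S] be any matrix of [Gamma] supported in [Supp X0]. A row
scaling lowers [kl S (X n)] by the relative entropy of [a] with respect to the
row sums of [X n], and a column scaling does the same with [b] and the column
sums ([kl_TR], [kl_TC]). This [gain n] does not depend on [S], and
[kl S (X n) >= 0], so the gains are summable.

Rates. Relative entropy dominates the squared Hellinger distance
([hellinger_le_kl]), so the Hellinger distances [defect n] between the marginal
corrected at step [n] and its target are summable too; they dominate the squares
of the ratios minus 1, whence the convergent series. Moreover [defect] is
nonincreasing from index 1 on ([defectS]), because a row scaling moves the
column sums by no more, in Hellinger distance, than it moves the row sums
([hellinger_TR]). A nonincreasing summable sequence is negligible with respect to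
1/n, which gives the convergence of [sqrt n (R_i - 1)] and [sqrt n (C_j - 1)]
to zero.

Convergence. All entries lie in [0, 1], so some subsequence converges to a
matrix [L]; since the ratios tend to 1, [L] is in [Gamma] and its support is in
[Supp X0]. Taking [S := L], the sequence [kl L (X n)] is nonincreasing and tends
to zero along the subsequence, so it tends to zero and [X n] tends to [L]
([ipfp_cvg_of_limit_point]). For general [S], boundedness of [kl S (X n)] forces
[Supp S] into [Supp L] ([limit_supp]).

Minimality. As [kl S X0 - kl S (X n)] is the sum of the first [n] gains, it is
the same for [S] and for [L]. Letting [n] tend to infinity gives the Pythagorean
identity [kl S X0 = kl S L + kl L X0] ([kl_pythagoras]), and [kl S L] is
nonnegative, zero only for [S = L]. The statement on products is the identity
[X n i j * product of the first n ratios = X0 i j] ([ipfp_prod]). *)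

Local Open Scope classical_set_scope.
Local Open Scope ring_scope.

(** * Relative entropy and Hellinger distance *)

Section Divergences.
Context {R : realType}.

(** Relative entropy and squared Hellinger distance of nonnegative families
on an arbitrary finite type: they are applied to the entries of matrices and
to vectors of row or column sums alike. Where [f t = 0] the term vanishes, so
[kl f g] is the relative entropy as soon as [f] is supported where [g] is. *)
Definition kl {T : finType} (f g : T -> R) : R :=
  \sum_t f t * ln (f t / g t).

Definition hellinger {T : finType} (f g : T -> R) : R :=
  \sum_t (Num.sqrt (f t) - Num.sqrt (g t)) ^+ 2.

(** With [u] and [v] the square roots of [y] and [x], this is
[ln (v / u) <= v / u - 1]. *)
Lemma entropy_term_ge (x y : R) : 0 <= x -> 0 <= y -> (0 < y -> 0 < x) ->
  y - x + (Num.sqrt y - Num.sqrt x) ^+ 2 <= y * ln (y / x).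
Proof.
move=> x0 y0 yx; have [y_gt0|] := ltP 0 y; last first.
  move=> y_le0; have -> : y = 0 by apply/le_anti/andP.
  by rewrite mul0r sqrtr0 !sub0r sqrrN sqr_sqrtr // addNr.
have x_gt0 := yx y_gt0.
have u0 : 0 < Num.sqrt y by rewrite sqrtr_gt0.
have v0 : 0 < Num.sqrt x by rewrite sqrtr_gt0.
rewrite -{1 3 4}(sqr_sqrtr y0) -{1 3}(sqr_sqrtr x0).
move: (Num.sqrt y) (Num.sqrt x) u0 v0 => u v u0 v0.
have le_ln : ln (v / u) <= v / u - 1.
  have := @le_ln1Dx R (v / u - 1); rewrite addrCA subrr addr0; apply.
  by rewrite ltrBrDr addNr divr_gt0.
have -> : ln (u ^+ 2 / v ^+ 2) = - ln (v / u) *+ 2.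
  rewrite -expr_div_n lnXn ?divr_gt0// -[in LHS]invf_div lnV ?posrE ?divr_gt0//.
have -> : u ^+ 2 - v ^+ 2 + (u - v) ^+ 2 = u ^+ 2 * ((1 - v / u) *+ 2).
  by field; rewrite gt_eqF.
rewrite ler_pM2l ?exprn_gt0// lerMn2r /=; lra.
Qed.

(** Plays the part of Pinsker's inequality, and says in particular that
[kl f g >= 0]. *)
Lemma hellinger_le_kl {T : finType} (f g : T -> R) :
  (forall t, 0 <= f t) -> (forall t, 0 <= g t) ->
  (forall t, 0 < f t -> 0 < g t) -> \sum_t f t = \sum_t g t ->
  hellinger f g <= kl f g.
Proof.
move=> f0 g0 fg sfg.
suff : \sum_t (f t - g t + (Num.sqrt (f t) - Num.sqrt (g t)) ^+ 2) <= kl f g.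
  by rewrite big_split /= sumrB sfg subrr add0r.
by apply: ler_sum => t _; apply: entropy_term_ge => //; exact: fg.
Qed.

Lemma le_sum_fin {T : finType} (f : T -> R) t :
  (forall s, 0 <= f s) -> f t <= \sum_s f s.
Proof. by move=> f0; rewrite (bigD1 t)//= lerDl sumr_ge0. Qed.

Lemma kl_refl {T : finType} (f : T -> R) : kl f f = 0.
Proof.
apply: big1 => t _; have [->|ft] := eqVneq (f t) 0; first by rewrite mul0r.
by rewrite divff// ln1 mulr0.
Qed.

(** All the terms [f ln (f / g) - f + g] of the relative entropy are
nonnegative, so a bound on [kl f g] controls each of them. This is how the
entries of the iterates are kept away from zero. *)
Lemma kl_ge_term {T : finType} (f g : T -> R) t :
  (forall t, 0 <= f t) -> (forall t, 0 <= g t) ->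
  (forall t, 0 < f t -> 0 < g t) -> \sum_t f t = \sum_t g t ->
  f t * ln (f t / g t) <= kl f g + f t.
Proof.
move=> f0 g0 fg sfg.
have term_ge0 s : 0 <= f s * ln (f s / g s) - (f s - g s).
  have := entropy_term_ge _ _ (g0 s) (f0 s) (fg s).
  by rewrite subr_ge0; apply: le_trans; rewrite lerDl sqr_ge0.
have -> : kl f g = \sum_s (f s * ln (f s / g s) - (f s - g s)).
  by rewrite !sumrB sfg subrr subr0.
rewrite (bigD1 t)//=; have := g0 t.
have : 0 <= \sum_(s | s != t) (f s * ln (f s / g s) - (f s - g s)).
  by apply: sumr_ge0.
lra.
Qed.

Lemma hellinger_ge0 {T : finType} (f g : T -> R) : 0 <= hellinger f g.
Proof. by apply: sumr_ge0 => t _; exact: sqr_ge0. Qed.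

Lemma hellinger_ge_term {T : finType} (f g : T -> R) t :
  (Num.sqrt (f t) - Num.sqrt (g t)) ^+ 2 <= hellinger f g.
Proof.
by apply: (le_sum_fin (fun s => _)) => s; exact: sqr_ge0.
Qed.

Lemma sqr_sub_le_hellinger {T : finType} (f g : T -> R) t :
  0 <= f t <= 1 -> 0 <= g t <= 1 -> (f t - g t) ^+ 2 <= 4 * hellinger f g.
Proof.
move=> /andP[f0 f1] /andP[g0 g1].
have := hellinger_ge_term f g t; rewrite -{2}(sqr_sqrtr f0) -{2}(sqr_sqrtr g0).
have : Num.sqrt (f t) <= 1 by rewrite -sqrtr1 ler_sqrt.
have : Num.sqrt (g t) <= 1 by rewrite -sqrtr1 ler_sqrt.
move: (sqrtr_ge0 (f t)) (sqrtr_ge0 (g t)).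
move: (Num.sqrt (f t)) (Num.sqrt (g t)) => u v u0 v0 v1 u1 uv.
rewrite subr_sqr exprMn mulrC; apply: ler_pM => //; rewrite ?sqr_ge0//.
have -> : 4 = 2 ^+ 2 :> R by rewrite -natrX.
by rewrite lerXn2r ?nnegrE; lra.
Qed.

(** The triangle inequality in l2 for the vectors of square roots, by adding
the terms one at a time; each addition is the Cauchy-Schwarz inequality in the
plane. It makes the Hellinger distance of two marginals at most that of the
matrices. *)
Lemma sqr_sqrt_sub_sum_le {T : finType} (f g : T -> R) :
  (forall t, 0 <= f t) -> (forall t, 0 <= g t) ->
  (Num.sqrt (\sum_t f t) - Num.sqrt (\sum_t g t)) ^+ 2 <= hellinger f g.
Proof.
move=> f0 g0.
pose K (x y z : R) := [/\ 0 <= x, 0 <= y & (Num.sqrt x - Num.sqrt y) ^+ 2 <= z].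
suff [] : K (\sum_t f t) (\sum_t g t) (hellinger f g) by [].
rewrite /hellinger; apply: (big_ind3 K) => [|x y z x' y' z' [x0 y0 h] [x'0 y'0 h']|t _].
- by split; rewrite ?sqrtr0 ?subrr ?expr0n.
- split; rewrite ?addr_ge0//; apply: le_trans (lerD h h').
  have := sqr_sqrtr (addr_ge0 x0 x'0); have := sqr_sqrtr (addr_ge0 y0 y'0).
  rewrite -{2}(sqr_sqrtr x0) -{2}(sqr_sqrtr x'0).
  rewrite -{2}(sqr_sqrtr y0) -{2}(sqr_sqrtr y'0).
  move: (sqrtr_ge0 (x + x')) (sqrtr_ge0 (y + y')).
  move: (sqrtr_ge0 x) (sqrtr_ge0 x') (sqrtr_ge0 y) (sqrtr_ge0 y').
  move: (Num.sqrt (x + x')) (Num.sqrt (y + y')) => s t.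
  move: (Num.sqrt x) (Num.sqrt x') (Num.sqrt y) (Num.sqrt y') => u w v z1.
  move=> u0 w0 v0 z0 s0 t0 tE sE.
  have cs : u * v + w * z1 <= s * t.
    rewrite -(@ler_pXn2r _ 2)// ?nnegrE ?addr_ge0 ?mulr_ge0// exprMn tE sE.
    have := sqr_ge0 (u * z1 - w * v); lra.
  have : (s - t) ^+ 2 = s ^+ 2 + t ^+ 2 - (s * t) *+ 2 by ring.
  rewrite sE tE => ->; lra.
- by split.
Qed.

End Divergences.

(** * Real sequences *)

Section Sequences.
Context {R : realType}.

Lemma cvg_nat_infty {f : nat -> nat} :
  (forall n, (n <= f n)%N) -> f @ \oo --> \oo.
Proof.
move=> f_ge A [N _ NA]; exists N => // n /= Nn.
by apply: NA => /=; exact: leq_trans Nn (f_ge n).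
Qed.

Lemma increasing_seq_ge_id {f : nat -> nat} : increasing_seq f ->
  forall n, (n <= f n)%N.
Proof.
move=> /increasing_seqP fS; elim=> // n IHn; exact: leq_ltn_trans IHn (fS n).
Qed.

Lemma nonneg_series_bounded_cvg (u : R^nat) (M : R) :
  (forall n, 0 <= u n) -> (forall n, series u n <= M) -> cvgn (series u).
Proof.
move=> u0 uM; apply: nondecreasing_is_cvgn; last first.
  by exists M => _ [n _ <-].
apply/nondecreasing_seqP => n; rewrite /series /= big_nat_recr //= lerDl; exact: u0.
Qed.

(** The terms with index from [n./2] to [n - 1] number at least [n / 2] and are all
at least [u n], hence [n * u n] is at most twice a slice of the series between two
indices that tend to infinity. Monotonicity is only asked from index 1, because
the start of the iteration need not have either marginal right. *)
Lemma nonincreasing_summable_mul_cvg0 (u : R^nat) :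
  (forall n, 0 <= u n) ->
  (forall m n, (0 < m)%N -> (m <= n)%N -> u n <= u m) ->
  cvgn (series u) -> (fun n => n%:R * u n) @ \oo --> (0 : R).
Proof.
move=> u0 u_noninc /cvg_ex[l u_l].
have half_oo : half @ \oo --> \oo.
  move=> A [N _ NA]; exists N.*2 => // n /= Nn; apply: NA => /=.
  by rewrite geq_half_double.
have half_cvg : (fun n => series u (half n)) @ \oo --> l.
  exact: cvg_comp half_oo u_l.
have cvg0 : (fun n => 2 * (series u n - series u (half n))) @ \oo --> (0 : R).
  rewrite -(mulr0 2) -(subrr l).
  by apply: cvgM; [exact: cvg_cst|apply: cvgB].
apply: squeeze_cvgr cvg0; last exact: cvg_cst.
near=> n; rewrite mulr_ge0//=.
have half_gt0 : (0 < n./2)%N by rewrite half_gt0; near: n; exact: nbhs_infty_ge.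
have le_half : (n./2 <= n)%N by lia.
have -> : series u n - series u n./2 = \sum_(n./2 <= k < n) u k.
  by rewrite /series /= sub_series_geq.
have : \sum_(n./2 <= k < n) u n <= \sum_(n./2 <= k < n) u k.
  rewrite !big_nat; apply: ler_sum => k /andP[nk kn]; apply: u_noninc.
    exact: leq_trans half_gt0 nk.
  exact: ltnW.
rewrite sumr_const_nat => /(ler_wpM2l (ler0n R 2)) sum_ge.
apply: le_trans sum_ge.
rewrite -[u n *+ _]mulr_natl mulrA -natrM; apply: ler_wpM2r => //.
by rewrite ler_nat; lia.
Unshelve. all: by end_near. Qed.

(** Successive extractions, one for each index. *)
Lemma bolzano_weierstrass_finite {I : finType} {u : I -> R^nat} {M : R} :
  (forall i n, `|u i n| <= M) ->
  exists2 f : nat -> nat, increasing_seq f & forall i, cvgn (u i \o f).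
Proof.
move=> uM.
suff [f f_inc f_cvg] : exists2 f : nat -> nat, increasing_seq f &
    forall i, i \in enum I -> cvgn (u i \o f).
  by exists f => // i; apply: f_cvg; rewrite mem_enum.
elim: (enum I) => [|i s [f f_inc f_cvg]]; first by exists id.
have [g g_inc g_cvg] : exists2 g, increasing_seq g & cvgn ((u i \o f) \o g).
  apply: bolzano_weierstrass; exists M; split; first exact: num_real.
  by move=> x Mx n _; apply: le_trans (uM _ _) (ltW Mx).
exists (f \o g) => [m n|j]; first by rewrite /= f_inc; exact: g_inc.
rewrite inE => /orP[/eqP->//|/f_cvg/cvg_ex[l fl]].
apply/cvg_ex; exists l; apply: cvg_comp fl.
exact: cvg_nat_infty (increasing_seq_ge_id g_inc).
Qed.

Lemma cvg_mx {p q : nat} (M : nat -> 'M[R]_(p, q)) (L : 'M[R]_(p, q)) :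
  (forall i j, (fun n => M n i j) @ \oo --> L i j) -> M @ \oo --> L.
Proof.
move=> ML A [P LP PA].
have : \forall n \near \oo, forall i j, P i j (M n i j).
  by apply: filter_forall => i; apply: filter_forall => j; exact: ML (LP i j).
by apply: filterS => n; exact: PA.
Qed.

Lemma cvg_sum_fin {T : finType} (u : T -> R^nat) (l : T -> R) :
  (forall t, u t @ \oo --> l t) ->
  (fun n => \sum_t u t n) @ \oo --> \sum_t l t.
Proof. by move=> ul; apply: cvg_big => //; exact: add_continuous. Qed.

(** Relative entropy is not continuous in its second argument where that
vanishes; the support condition on the limit [l] is what excludes this. *)
Lemma kl_cvg {T : finType} (f l : T -> R) (g : nat -> T -> R) :
  (forall t, 0 <= f t) -> (forall t, 0 < f t -> 0 < l t) ->
  (forall t, (fun n => g n t) @ \oo --> l t) ->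
  (fun n => kl f (g n)) @ \oo --> kl f l.
Proof.
move=> f0 fl gl; rewrite /kl; apply: cvg_sum_fin => t.
have [->|ft] := eqVneq (f t) 0.
  by under eq_fun do rewrite mul0r; rewrite mul0r; exact: cvg_cst.
have ft0 : 0 < f t by rewrite lt0r ft f0.
apply: cvgM; first exact: cvg_cst.
apply: continuous_cvg; first by apply: continuous_ln; rewrite divr_gt0// fl.
by apply: cvgM; [exact: cvg_cst|apply: cvgV; rewrite ?gt_eqF ?fl].
Qed.

Lemma sqr_le_cvg0 (w d : R^nat) :
  (\forall n \near \oo, w n ^+ 2 <= d n) -> d @ \oo --> (0 : R) ->
  w @ \oo --> (0 : R).
Proof.
move=> wd /cvgr0Pnorm_lt d0; apply/cvgr0Pnorm_lt => e e0; near=> n.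
rewrite -(@ltr_pXn2r _ 2)// ?nnegrE ?ltW// -normrX ger0_norm ?sqr_ge0//.
have d_lt : `|d n| < e ^+ 2 by near: n; apply: d0; exact: exprn_gt0.
apply: le_lt_trans d_lt; apply: le_trans (ler_norm _).
by near: n.
Unshelve. all: by end_near. Qed.

Lemma sqrt_rate_cvg (v d : R^nat) (K : R) :
  (forall n, (0 < n)%N -> (v n - 1) ^+ 2 <= K * d n) ->
  (fun n => n%:R * d n) @ \oo --> (0 : R) ->
  (fun n => Num.sqrt n%:R * (v n - 1)) @ \oo --> (0 : R) /\
  v @ \oo --> (1 : R).
Proof.
move=> v_le d0.
set w := fun n => Num.sqrt n%:R * (v n - 1).
have w0 : w @ \oo --> (0 : R).
  apply: (@sqr_le_cvg0 _ (fun n => K * (n%:R * d n))); last first.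
    by rewrite -(mulr0 K); apply: cvgM; [exact: cvg_cst|].
  near=> n; rewrite /w exprMn sqr_sqrtr// [leRHS]mulrCA ler_wpM2l// v_le//.
  by near: n; exact: nbhs_infty_gt.
split=> //; apply/subr_cvg0.
have norm_w0 : (fun n => `|w n|) @ \oo --> (0 : R).
  by rewrite -(normr0 R); apply: cvg_norm.
apply/norm_cvg0P; apply: squeeze_cvgr norm_w0; last exact: cvg_cst.
near=> n; rewrite normr_ge0 /= /w normrM ler_peMl// ger0_norm ?sqrtr_ge0//.
rewrite -[X in X <= _]sqrtr1 ler_sqrt// ler1n.
by near: n; exact: nbhs_infty_gt.
Unshelve. all: by end_near. Qed.

Lemma sqr_ratio_le (s w : R) (d : R) : 0 < w -> (w - s) ^+ 2 <= 4 * d ->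
  (s / w - 1) ^+ 2 <= 4 / w ^+ 2 * d.
Proof.
move=> w0 swd; have -> : (s / w - 1) ^+ 2 = (w - s) ^+ 2 / w ^+ 2.
  by field; rewrite gt_eqF.
by rewrite [leRHS]mulrAC ler_pM2r ?invr_gt0 ?exprn_gt0.
Qed.

Lemma sum_even_le {u : R^nat} n : (forall k, 0 <= u k) ->
  \sum_(0 <= k < n) u (2 * k)%N <= series u (2 * n)%N.
Proof.
move=> u0; elim: n => [|n IHn]; first by rewrite muln0 /series /= !big_geq.
rewrite mulnS addnC addn2 /series /= !big_nat_recr//=.
by rewrite -addrA lerD ?lerDl.
Qed.

Lemma sum_odd_le {u : R^nat} n : (forall k, 0 <= u k) ->
  \sum_(0 <= k < n) u (2 * k).+1 <= series u (2 * n)%N.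
Proof.
move=> u0; elim: n => [|n IHn]; first by rewrite muln0 /series /= !big_geq.
rewrite mulnS addnC addn2 /series /= !big_nat_recr//=.
by rewrite -addrA lerD ?lerDr.
Qed.

End Sequences.

(** * Effect of one scaling step *)

Section Scaling.
Context {R : realType}.

Definition entries {p q : nat} (X : 'M[R]_(p, q)) (ij : 'I_p * 'I_q) : R :=
  X ij.1 ij.2.

Lemma klE {p q : nat} (S X : 'M[R]_(p, q)) :
  kl (entries S) (entries X) = \sum_i \sum_j S i j * ln (S i j / X i j).
Proof. by rewrite pair_bigA. Qed.

Lemma kl_tr {p q : nat} (S X : 'M[R]_(p, q)) :
  kl (entries S^T) (entries X^T) = kl (entries S) (entries X).
Proof.
rewrite !klE exchange_big; apply: eq_bigr => i _; apply: eq_bigr => j _.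
by rewrite !mxE.
Qed.

Lemma rowsum_tr {p q : nat} (X : 'M[R]_(p, q)) : rowsum X^T = colsum X.
Proof. by apply/funext => j; apply: eq_bigr => i _; rewrite mxE. Qed.

Lemma colsum_tr {p q : nat} (X : 'M[R]_(p, q)) : colsum X^T = rowsum X.
Proof. by apply/funext => i; apply: eq_bigr => j _; rewrite mxE. Qed.

Lemma Gamma0_tr {p q : nat} {X : 'M[R]_(p, q)} : Gamma0 X -> Gamma0 X^T.
Proof.
move=> [X0 rX cX]; split; rewrite ?rowsum_tr ?colsum_tr//.
by move=> i j; rewrite mxE.
Qed.

(** Reduces every statement on column scalings to the one on row scalings. *)
Lemma TC_tr {p q : nat} (b : 'rV[R]_q) (X : 'M[R]_(p, q)) :
  TC b X = (TR b X^T)^T.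
Proof. by apply/matrixP => i j; rewrite !mxE /rowratio rowsum_tr. Qed.

Lemma sum_colsum {p q : nat} (Y : 'M[R]_(p, q)) : \sum_j colsum Y j = \sum_i rowsum Y i.
Proof. by rewrite /rowsum exchange_big. Qed.

Section Rows.
Context {p q : nat} {a : 'rV[R]_p}.
Hypothesis a_gt0 : forall i, 0 < a 0 i.
Implicit Types X S : 'M[R]_(p, q).

Lemma rowratio_gt0 {X} i : Gamma0 X -> 0 < rowratio a X i.
Proof. by move=> [_ rX _]; rewrite divr_gt0. Qed.

Lemma TR_gt0 {X} i j : Gamma0 X -> (0 < TR a X i j) = (0 < X i j).
Proof. by move=> GX; rewrite mxE pmulr_lgt0// invr_gt0 rowratio_gt0. Qed.

Lemma rowsum_TR {X} : Gamma0 X -> rowsum (TR a X) = a 0.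
Proof.
move=> GX; apply/funext => i; rewrite /rowsum.
under eq_bigr do rewrite mxE.
rewrite -mulr_suml -/(rowsum X i) /rowratio invf_div mulrCA divff ?mulr1//.
by case: GX => _ /(_ i)/gt_eqF->.
Qed.

(** Positive column sums survive because scaling does not change the support. *)
Lemma TR_Gamma0 {X} : Gamma0 X -> Gamma0 (TR a X).
Proof.
move=> GX; have [X0 rX cX] := GX.
have T0 i j : 0 <= TR a X i j by rewrite mxE divr_ge0// ltW// rowratio_gt0.
split=> // [i|j]; first by rewrite rowsum_TR.
rewrite lt_def sumr_ge0// andbT; apply/negP => /eqP cT.
have := cX j; rewrite lt_def => /andP[/eqP + _]; apply.
apply: big1 => i _; apply/le_anti; rewrite X0 andbT leNgt -TR_gt0//.
by rewrite -leNgt -cT /colsum (bigD1 i)//= lerDl sumr_ge0.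
Qed.

(** Scaling row [i] by [a i / rowsum X i] changes each logarithm by a quantity
that depends on [i] only, and [S] gives it the weight [a i]. The decrease is
therefore the same for all [S] with row sums [a]. *)
Lemma kl_TR {S X} : Gamma0 X -> (forall i j, 0 <= S i j) ->
  (forall i j, 0 < S i j -> 0 < X i j) -> rowsum S = a 0 ->
  kl (entries S) (entries (TR a X)) =
    kl (entries S) (entries X) - kl (a 0) (rowsum X).
Proof.
move=> GX S0 SX rS; rewrite !klE /kl -sumrB; apply: eq_bigr => i _.
have r_gt0 := rowratio_gt0 i GX.
have -> : a 0 i * ln (a 0 i / rowsum X i) = - \sum_j S i j * ln (rowratio a X i).
  by rewrite -mulr_suml -/(rowsum S i) rS -mulrN -lnV ?posrE// invf_div.
rewrite opprK -big_split /=; apply: eq_bigr => j _.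
have [->|Sij] := eqVneq (S i j) 0; first by rewrite !mul0r addr0.
have S_gt0 : 0 < S i j by rewrite lt_def Sij S0.
rewrite -mulrDr -lnM ?posrE ?r_gt0 ?divr_gt0 ?SX// mxE; congr (_ * ln _).
by field; rewrite !gt_eqF// SX.
Qed.

(** The Hellinger distance between [X] and [TR a X] is exactly the one between
their row sums, since the two matrices are proportional on each row; passing to
column sums can only decrease it. *)
Lemma hellinger_TR {X} : Gamma0 X ->
  hellinger (colsum X) (colsum (TR a X)) <= hellinger (a 0) (rowsum X).
Proof.
move=> GX; have [X0 rX _] := GX; have [T0 _ _] := TR_Gamma0 GX.
have -> : hellinger (a 0) (rowsum X) =
    \sum_j hellinger (X ^~ j) (TR a X ^~ j).
  rewrite /hellinger exchange_big; apply: eq_bigr => i _ /=.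
  have r_gt0 := rowratio_gt0 i GX.
  set s := Num.sqrt (rowratio a X i).
  have s_gt0 : 0 < s by rewrite sqrtr_gt0.
  under eq_bigr => j _.
    have -> : (Num.sqrt (X i j) - Num.sqrt (TR a X i j)) ^+ 2 =
        X i j * (1 - s^-1) ^+ 2.
      rewrite mxE sqrtrM// sqrtrV ?ltW// -/s -{3}(sqr_sqrtr (X0 i j)); ring.
    over.
  rewrite -mulr_suml -/(rowsum X i).
  have -> : rowsum X i = a 0 i * s ^+ 2.
    by rewrite sqr_sqrtr ?ltW// mulrC divfK// gt_eqF.
  rewrite sqrtrM ?ltW// sqrtr_sqr (gtr0_norm s_gt0).
  rewrite -{3}(sqr_sqrtr (ltW (a_gt0 i))); field; exact: lt0r_neq0.
by apply: ler_sum => j _; exact: sqr_sqrt_sub_sum_le.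
Qed.

End Rows.

Section Columns.
Context {p q : nat} {b : 'rV[R]_q}.
Hypothesis b_gt0 : forall j, 0 < b 0 j.
Implicit Types X S : 'M[R]_(p, q).

Lemma TC_gt0 {X} i j : Gamma0 X -> (0 < TC b X i j) = (0 < X i j).
Proof.
by move=> /Gamma0_tr GX; rewrite TC_tr mxE (TR_gt0 b_gt0)// mxE.
Qed.

Lemma colsum_TC {X} : Gamma0 X -> colsum (TC b X) = b 0.
Proof. by move=> /Gamma0_tr GX; rewrite TC_tr colsum_tr rowsum_TR. Qed.

Lemma TC_Gamma0 {X} : Gamma0 X -> Gamma0 (TC b X).
Proof.
by move=> /Gamma0_tr GX; rewrite TC_tr; apply/Gamma0_tr/(TR_Gamma0 b_gt0).
Qed.

Lemma kl_TC {S X} : Gamma0 X -> (forall i j, 0 <= S i j) ->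
  (forall i j, 0 < S i j -> 0 < X i j) -> colsum S = b 0 ->
  kl (entries S) (entries (TC b X)) =
    kl (entries S) (entries X) - kl (b 0) (colsum X).
Proof.
move=> /Gamma0_tr GX S0 SX cS.
rewrite TC_tr -kl_tr trmxK -(kl_tr S X) -rowsum_tr; apply: (kl_TR b_gt0) => //.
- by move=> i j; rewrite mxE.
- by move=> i j; rewrite !mxE; exact: SX.
- by rewrite rowsum_tr.
Qed.

Lemma hellinger_TC {X} : Gamma0 X ->
  hellinger (rowsum X) (rowsum (TC b X)) <= hellinger (b 0) (colsum X).
Proof.
move=> /Gamma0_tr GX; have := hellinger_TR b_gt0 GX.
by rewrite TC_tr colsum_tr !rowsum_tr -colsum_tr.
Qed.

End Columns.

End Scaling.

(** * The iterates and their limit *)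

Section Iterates.
Context {R : realType} {p q : nat} {a : 'rV[R]_p} {b : 'rV[R]_q}.
Context {X0 : 'M[R]_(p, q)}.
Hypothesis a_gt0 : forall i, 0 < a 0 i.
Hypothesis b_gt0 : forall j, 0 < b 0 j.
Hypothesis a_sum1 : \sum_(i < p) a 0 i = 1.
Hypothesis b_sum1 : \sum_(j < q) b 0 j = 1.
Hypothesis X0_Gamma1 : Gamma1 X0.

Let X := ipfp a b X0.

Lemma ipfp_Gamma0 n : Gamma0 (X n).
Proof.
elim: n => [|n IHn]; first by case: X0_Gamma1.
by rewrite /X /=; case: ifP => _; [exact: TC_Gamma0|exact: TR_Gamma0].
Qed.

Lemma ipfp_ge0 n i j : 0 <= X n i j.
Proof. by case: (ipfp_Gamma0 n). Qed.

Lemma ipfp_gt0 n i j : (0 < X n i j) = (0 < X0 i j).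
Proof.
elim: n => // n IHn; rewrite -IHn /X /=.
by case: ifP => _; [apply: TC_gt0|apply: TR_gt0] => //; exact: ipfp_Gamma0.
Qed.

Lemma rowsum_ipfp_odd {n} : odd n -> rowsum (X n) = a 0.
Proof.
case: n => // n; rewrite oddS /X /= => /negPf ->.
by apply: rowsum_TR => //; exact: ipfp_Gamma0.
Qed.

Lemma colsum_ipfp_even {n} : (0 < n)%N -> ~~ odd n -> colsum (X n) = b 0.
Proof.
case: n => // n _; rewrite oddS negbK /X /= => ->.
by apply: colsum_TC => //; exact: ipfp_Gamma0.
Qed.

Lemma sum_rowsum_ipfp n : \sum_i rowsum (X n) i = 1.
Proof.
have [n_odd|n_even] := boolP (odd n); first by rewrite rowsum_ipfp_odd.
case: (posnP n) => [->|n_gt0]; first by case: X0_Gamma1.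
by rewrite -sum_colsum colsum_ipfp_even.
Qed.

Lemma sum_colsum_ipfp n : \sum_j colsum (X n) j = 1.
Proof. by rewrite sum_colsum sum_rowsum_ipfp. Qed.

Lemma sum_entries_ipfp n : \sum_ij entries (X n) ij = 1.
Proof. by rewrite -(sum_rowsum_ipfp n) /rowsum pair_bigA. Qed.

Lemma ipfp_le1 n i j : X n i j <= 1.
Proof.
rewrite -(sum_entries_ipfp n).
by apply: (le_sum_fin (entries (X n)) (i, j)) => ij; exact: ipfp_ge0.
Qed.

(** The Hellinger distance between the target and the marginal that step [n]
is about to correct. *)
Definition defect n : R :=
  if odd n then hellinger (b 0) (colsum (X n))
  else hellinger (a 0) (rowsum (X n)).

Definition gain n : R :=
  if odd n then kl (b 0) (colsum (X n)) else kl (a 0) (rowsum (X n)).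

Lemma defect_ge0 n : 0 <= defect n.
Proof. by rewrite /defect; case: ifP => _; exact: hellinger_ge0. Qed.

Lemma defect_le_gain n : defect n <= gain n.
Proof.
have [_ rX cX] := ipfp_Gamma0 n.
rewrite /defect /gain; case: ifP => _; apply: hellinger_le_kl => //;
  try by move=> t; exact: ltW.
- by rewrite b_sum1 sum_colsum_ipfp.
- by rewrite a_sum1 sum_rowsum_ipfp.
Qed.

(** Before step [n], the marginal that is not corrected agrees with its target
(this needs [n > 0]); so its distance to the target after the step is the
distance between its values before and after, which the correction made on the
other side bounds. *)
Lemma defectS n : (0 < n)%N -> defect n.+1 <= defect n.
Proof.
move=> n_gt0; rewrite /defect oddS /X /=; case: (boolP (odd n)) => n_odd /=.
  rewrite -{1}(rowsum_ipfp_odd n_odd); apply: hellinger_TC => //.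
  exact: ipfp_Gamma0.
rewrite -{1}(colsum_ipfp_even n_gt0 n_odd); apply: hellinger_TR => //.
exact: ipfp_Gamma0.
Qed.

Lemma defect_noninc m n : (0 < m)%N -> (m <= n)%N -> defect n <= defect m.
Proof.
move=> m0 /subnK <-; elim: (n - m)%N => // k IHk.
by apply: le_trans IHk; apply: defectS; rewrite addn_gt0 m0 orbT.
Qed.

(** At odd [n] the row sums are exact and the left-hand side is zero. *)
Lemma rowratio_defect n i :
  (rowratio a (X n) i - 1) ^+ 2 <= 4 / a 0 i ^+ 2 * defect n.
Proof.
have [_ rX _] := ipfp_Gamma0 n.
apply: sqr_ratio_le => //; have [n_odd|n_even] := boolP (odd n).
  by rewrite rowsum_ipfp_odd// subrr expr0n mulr_ge0// defect_ge0.
rewrite /defect (negPf n_even); apply: sqr_sub_le_hellinger; apply/andP; split.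
- exact: ltW.
- by rewrite -a_sum1; apply: le_sum_fin => k; exact: ltW.
- exact: ltW.
- by rewrite -(sum_rowsum_ipfp n); apply: le_sum_fin => k; exact: ltW.
Qed.

Lemma colratio_defect n j : (0 < n)%N ->
  (colratio b (X n) j - 1) ^+ 2 <= 4 / b 0 j ^+ 2 * defect n.
Proof.
move=> n_gt0; have [_ _ cX] := ipfp_Gamma0 n.
apply: sqr_ratio_le => //; have [n_odd|n_even] := boolP (odd n); last first.
  by rewrite colsum_ipfp_even// subrr expr0n mulr_ge0// defect_ge0.
rewrite /defect n_odd; apply: sqr_sub_le_hellinger; apply/andP; split.
- exact: ltW.
- by rewrite -b_sum1; apply: le_sum_fin => k; exact: ltW.
- exact: ltW.
- by rewrite -(sum_colsum_ipfp n); apply: le_sum_fin => k; exact: ltW.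
Qed.

Lemma ipfp_prod n i j : 
  X n i j * \prod_(0 <= m < n)
    (if odd m then colratio b (X m) j else rowratio a (X m) i) = X0 i j.
Proof.
elim: n => [|n IHn]; first by rewrite big_geq ?mulr1.
rewrite big_nat_recr//= -{}IHn mulrCA mulrC; congr (_ * _).
have [_ rX cX] := ipfp_Gamma0 n.
rewrite /X /=; case: ifP => _; rewrite mxE divfK// gt_eqF// divr_gt0//.
Qed.

Section Target.
Context {S : 'M[R]_(p, q)}.
Hypothesis SG : GammaSub a b X0 S.

Lemma target_ge0 i j : 0 <= S i j.
Proof. by case: SG => -[[]]. Qed.

Lemma rowsum_target : rowsum S = a 0.
Proof. by apply/funext => i; case: SG => -[_ ->]. Qed.

Lemma colsum_target : colsum S = b 0.
Proof. by apply/funext => j; case: SG => -[_ _ ->]. Qed.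

Lemma target_supp n i j : 0 < S i j -> 0 < X n i j.
Proof.
move=> Sij; rewrite ipfp_gt0; case: SG => _ /fintype.subsetP/(_ (i, j)).
by rewrite !inE; exact.
Qed.

Lemma sum_entries_target : \sum_ij entries S ij = 1.
Proof. by rewrite -a_sum1 -rowsum_target /rowsum pair_bigA. Qed.

Lemma kl_ipfpS n :
  kl (entries S) (entries (X n.+1)) = kl (entries S) (entries (X n)) - gain n.
Proof.
have GX := ipfp_Gamma0 n; rewrite /gain /X /=.
case: ifP => _; [apply: kl_TC|apply: kl_TR] => //; try exact: target_ge0.
- exact: target_supp.
- exact: colsum_target.
- exact: target_supp.
- exact: rowsum_target.
Qed.

(** The right-hand side depends on [S] only through its first term. The
Pythagorean identity below rests on this. *)
Lemma kl_ipfp n :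
  kl (entries S) (entries (X n)) = kl (entries S) (entries X0) - series gain n.
Proof.
elim: n => [|n IHn]; first by rewrite /series /= big_geq// subr0.
by rewrite kl_ipfpS IHn /series /= big_nat_recr//= opprD addrA.
Qed.

Lemma hellinger_le_kl_ipfp n :
  hellinger (entries S) (entries (X n)) <= kl (entries S) (entries (X n)).
Proof.
apply: hellinger_le_kl => [ij|ij|ij|].
- exact: target_ge0.
- exact: ipfp_ge0.
- exact: target_supp.
- by rewrite sum_entries_target sum_entries_ipfp.
Qed.

Lemma kl_ipfp_noninc m n : (m <= n)%N ->
  kl (entries S) (entries (X n)) <= kl (entries S) (entries (X m)).
Proof.
move=> /subnK <-; elim: (n - m)%N => // k IHk; apply: le_trans IHk.
rewrite addSn kl_ipfpS lerBlDr lerDl.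
exact: le_trans (defect_ge0 _) (defect_le_gain _).
Qed.

Lemma kl_ipfp_ge0 n : 0 <= kl (entries S) (entries (X n)).
Proof. exact: le_trans (hellinger_ge0 _ _) (hellinger_le_kl_ipfp n). Qed.

Lemma series_defect_le n : series defect n <= kl (entries S) (entries X0).
Proof.
apply: (@le_trans _ _ (series gain n)).
  by apply: ler_sum => k _; exact: defect_le_gain.
by rewrite -subr_ge0 -kl_ipfp kl_ipfp_ge0.
Qed.

Lemma mul_defect_cvg0 : (fun n => n%:R * defect n) @ \oo --> (0 : R).
Proof.
apply: nonincreasing_summable_mul_cvg0; first exact: defect_ge0.
  exact: defect_noninc.
apply: nonneg_series_bounded_cvg series_defect_le; exact: defect_ge0.
Qed.

Lemma rowratio_rate i :
  (fun n => Num.sqrt n%:R * (rowratio a (X n) i - 1)) @ \oo --> (0 : R) /\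
  (fun n => rowratio a (X n) i) @ \oo --> (1 : R).
Proof.
apply: sqrt_rate_cvg mul_defect_cvg0 => n _; exact: rowratio_defect.
Qed.

Lemma colratio_rate j :
  (fun n => Num.sqrt n%:R * (colratio b (X n) j - 1)) @ \oo --> (0 : R) /\
  (fun n => colratio b (X n) j) @ \oo --> (1 : R).
Proof. apply: sqrt_rate_cvg mul_defect_cvg0 => n; exact: colratio_defect. Qed.

Lemma rowratio_series_cvg i :
  cvgn (series (fun n => (rowratio a (X (2 * n)%N) i - 1) ^+ 2)).
Proof.
apply: (@nonneg_series_bounded_cvg _ _
  (4 / a 0 i ^+ 2 * kl (entries S) (entries X0))) => n; first exact: sqr_ge0.
have K_ge0 : 0 <= 4 / a 0 i ^+ 2 by rewrite divr_ge0 ?sqr_ge0.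
apply: le_trans (ler_wpM2l K_ge0 (series_defect_le (2 * n)%N)).
apply: le_trans (ler_wpM2l K_ge0 (sum_even_le n defect_ge0)).
rewrite mulr_sumr; apply: ler_sum => k _; exact: rowratio_defect.
Qed.

Lemma colratio_series_cvg j :
  cvgn (series (fun n => (colratio b (X (2 * n).+1) j - 1) ^+ 2)).
Proof.
apply: (@nonneg_series_bounded_cvg _ _
  (4 / b 0 j ^+ 2 * kl (entries S) (entries X0))) => n; first exact: sqr_ge0.
have K_ge0 : 0 <= 4 / b 0 j ^+ 2 by rewrite divr_ge0 ?sqr_ge0.
apply: le_trans (ler_wpM2l K_ge0 (series_defect_le (2 * n)%N)).
apply: le_trans (ler_wpM2l K_ge0 (sum_odd_le n defect_ge0)).
rewrite mulr_sumr; apply: ler_sum => k _; exact: colratio_defect.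
Qed.

Lemma ipfp_limit_point : exists (L : 'M[R]_(p, q)) (f : nat -> nat),
  [/\ increasing_seq f,
      forall i j, (fun n => X (f n) i j) @ \oo --> L i j &
      GammaSub a b X0 L].
Proof.
have X_bounded (ij : 'I_p * 'I_q) n : `|entries (X n) ij| <= 1.
  by rewrite ger0_norm ?ipfp_ge0 ?ipfp_le1.
have [f f_inc f_cvg] :=
  bolzano_weierstrass_finite (u := fun ij n => entries (X n) ij) X_bounded.
have f_oo := cvg_nat_infty (increasing_seq_ge_id f_inc).
pose L : 'M[R]_(p, q) :=
  \matrix_(i, j) limn ((fun n => entries (X n) (i, j)) \o f).
have XfL i j : (fun n => X (f n) i j) @ \oo --> L i j.
  by rewrite mxE; exact: (f_cvg (i, j)).
have L_ge0 i j : 0 <= L i j.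
  rewrite mxE; apply: limr_ge; first exact: (f_cvg (i, j)).
  by near=> n; exact: ipfp_ge0.
have rL i : rowsum L i = a 0 i.
  have rowL : (fun n => rowsum (X (f n)) i) @ \oo --> rowsum L i.
    exact: cvg_sum_fin.
  have rowa : (fun n => rowsum (X (f n)) i) @ \oo --> a 0 i.
    have -> : (fun n => rowsum (X (f n)) i) =
        (fun n => rowratio a (X (f n)) i * a 0 i).
      by apply/funext => n; rewrite /rowratio divfK// gt_eqF.
    rewrite -[X in _ --> X]mul1r; apply: cvgM; last exact: cvg_cst.
    exact: cvg_comp f_oo (rowratio_rate i).2.
  exact: norm_cvg_unique rowL rowa.
have cL j : colsum L j = b 0 j.
  have colL : (fun n => colsum (X (f n)) j) @ \oo --> colsum L j.
    exact: cvg_sum_fin.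
  have colb : (fun n => colsum (X (f n)) j) @ \oo --> b 0 j.
    have -> : (fun n => colsum (X (f n)) j) =
        (fun n => colratio b (X (f n)) j * b 0 j).
      by apply/funext => n; rewrite /colratio divfK// gt_eqF.
    rewrite -[X in _ --> X]mul1r; apply: cvgM; last exact: cvg_cst.
    exact: cvg_comp f_oo (colratio_rate j).2.
  exact: norm_cvg_unique colL colb.
exists L, f; split=> //; split; first split=> //.
  by split=> // k; rewrite ?rL ?cL.
apply/fintype.subsetP => -[i j]; rewrite !inE /= !lt_def; apply: contraTT.
have := ipfp_gt0 0 i j; have [[X0_ge0 _ _] _] := X0_Gamma1.
rewrite X0_ge0 !andbT negbK => _ /eqP X0ij.
have Xf0 : (fun n => X (f n) i j) @ \oo --> (0 : R).
  apply: cvg_near_cst; near=> n; apply/le_anti.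
  by rewrite ipfp_ge0 andbT leNgt ipfp_gt0 X0ij ltxx.
by rewrite negb_and negbK (norm_cvg_unique (XfL i j) Xf0) eqxx.
Unshelve. all: by end_near. Qed.

End Target.

(** The limit point [L] is itself an admissible [S], so the relative entropy of
[L] with respect to the iterates is nonincreasing. It tends to zero along the
subsequence, hence along the whole sequence, and it dominates the Hellinger
distance. *)
Lemma ipfp_cvg_of_limit_point (L : 'M[R]_(p, q)) (f : nat -> nat) :
  increasing_seq f -> (forall i j, (fun n => X (f n) i j) @ \oo --> L i j) ->
  GammaSub a b X0 L ->
  (fun n => kl (entries L) (entries (X n))) @ \oo --> (0 : R) /\
  forall i j, (fun n => X n i j) @ \oo --> L i j.
Proof.
move=> f_inc XfL LG.
have f_oo := cvg_nat_infty (increasing_seq_ge_id f_inc).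
have kl0 : (fun n => kl (entries L) (entries (X n))) @ \oo --> (0 : R).
  have /cvg_ex[l kl_l] : cvgn (fun n => kl (entries L) (entries (X n))).
    apply: nonincreasing_is_cvgn; first exact: kl_ipfp_noninc.
    by exists 0 => _ [n _ <-]; exact: kl_ipfp_ge0.
  have kl_f : (fun n => kl (entries L) (entries (X (f n)))) @ \oo -->
      kl (entries L) (entries L).
    apply: kl_cvg => // [ij|ij]; first exact: target_ge0.
    exact: XfL.
  rewrite (kl_refl _) in kl_f.
  by rewrite (norm_cvg_unique kl_f (cvg_comp _ _ f_oo kl_l)).
split=> // i j; apply/subr_cvg0.
apply: (@sqr_le_cvg0 _ _ (fun n => 4 * kl (entries L) (entries (X n)))).
  near=> n; rewrite -sqrrN opprB.
  apply: le_trans (_ : 4 * hellinger (entries L) (entries (X n)) <= _).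
    apply: (@sqr_sub_le_hellinger _ _ (entries L) (entries (X n)) (i, j)).
      rewrite target_ge0 //=.
      by rewrite -(sum_entries_target LG) le_sum_fin// => ij; exact: target_ge0.
    by rewrite ipfp_ge0 ipfp_le1.
  by rewrite ler_wpM2l// hellinger_le_kl_ipfp.
by rewrite -(mulr0 4); apply: cvgM; [exact: cvg_cst|].
Unshelve. all: by end_near. Qed.

Section Limit.
Context {L : 'M[R]_(p, q)}.
Hypothesis LG : GammaSub a b X0 L.
Hypothesis kl0 : (fun n => kl (entries L) (entries (X n))) @ \oo --> (0 : R).
Hypothesis XL : forall i j, (fun n => X n i j) @ \oo --> L i j.

(** [kl S (X n)] stays below its initial value [K]; by [kl_ge_term] this bounds
[ln (S i j / X n i j)], so [X n i j] has a positive lower bound. *)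
Lemma limit_supp {S : 'M[R]_(p, q)} (SG : GammaSub a b X0 S) i j :
  0 < S i j -> 0 < L i j.
Proof.
move=> Sij.
set K := kl (entries S) (entries X0).
have X_ge n : S i j * expR (- ((K + S i j) / S i j)) <= X n i j.
  have Xij : 0 < X n i j by exact: (target_supp SG).
  have term_le : S i j * ln (S i j / X n i j) <= K + S i j.
    apply: le_trans (_ : kl (entries S) (entries (X n)) + S i j <= _); last first.
      by rewrite lerD2r (kl_ipfp_noninc SG _ _ (leq0n n)).
    apply: (kl_ge_term (entries S) (entries (X n)) (i, j)) => [ij|ij|ij|].
    - exact: (target_ge0 SG).
    - exact: ipfp_ge0.
    - exact: (target_supp SG).
    - by rewrite (sum_entries_target SG) sum_entries_ipfp.
  have : ln (S i j / X n i j) <= (K + S i j) / S i j.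
    by rewrite ler_pdivlMr// mulrC.
  rewrite -ler_expR lnK ?posrE ?divr_gt0// ler_pdivrMr// => S_le.
  by rewrite expRN -ler_pdivlMr ?invr_gt0 ?expR_gt0// invrK mulrC.
rewrite (lt_le_trans _ (_ : S i j * expR (- ((K + S i j) / S i j)) <= _))//.
  by rewrite mulr_gt0// expR_gt0.
rewrite -(norm_cvg_lim (XL i j)); apply: limr_ge; first exact: (cvgP _ (XL i j)).
by near=> n.
Unshelve. all: by end_near. Qed.

(** The difference [kl S (X n) - kl L (X n)] does not depend on [n]: compare
its initial value with its limit. *)
Lemma kl_pythagoras {S : 'M[R]_(p, q)} (SG : GammaSub a b X0 S) :
  kl (entries S) (entries X0) =
    kl (entries S) (entries L) + kl (entries L) (entries X0).
Proof.
have kl_S : (fun n => kl (entries S) (entries (X n))) @ \oo -->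
    kl (entries S) (entries L).
  apply: kl_cvg => [ij|ij|ij]; first exact: (target_ge0 SG).
    exact: limit_supp.
  exact: XL.
have diff_cst : (fun n => kl (entries S) (entries (X n)) -
      kl (entries L) (entries (X n))) @ \oo -->
    kl (entries S) (entries X0) - kl (entries L) (entries X0).
  apply: cvg_near_cst; near=> n; rewrite (kl_ipfp SG) (kl_ipfp LG).
  by rewrite opprB addrA subrK.
have := norm_cvg_unique (cvgB kl_S kl0) diff_cst.
by rewrite subr0 => ->; rewrite subrK.
Unshelve. all: by end_near. Qed.

Lemma hellinger_le_kl_limit {S : 'M[R]_(p, q)} (SG : GammaSub a b X0 S) :
  hellinger (entries S) (entries L) <= kl (entries S) (entries L).
Proof.
apply: hellinger_le_kl => [ij|ij|ij|].
- exact: (target_ge0 SG).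
- exact: (target_ge0 LG).
- exact: limit_supp.
- by rewrite (sum_entries_target SG) (sum_entries_target LG).
Qed.

Lemma relent_target {S : 'M[R]_(p, q)} (SG : GammaSub a b X0 S) :
  relent S X0 = (kl (entries S) (entries X0))%:E.
Proof.
have [_ SX0] := SG; rewrite /relent SX0 big_mkcond /=; congr (_%:E).
apply: eq_bigr => ij _; case: ifPn => // ijX0.
have ijS : ij \notin Supp S by apply: contraNN ijX0; exact: fintype.subsetP.
have -> : entries S ij = 0; last by rewrite mul0r.
apply/le_anti; rewrite (target_ge0 SG) andbT leNgt; apply: contraNN ijS.
by rewrite inE.
Qed.

(** By the Pythagorean identity the excess of [relent Y X0] over its value at
[L] is [kl Y L], which is nonnegative and vanishes only when [Y = L]. *)
Lemma limit_unique_minimiser :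
  [set Y | GammaSub a b X0 Y /\
           forall Z, GammaSub a b X0 Z -> (relent Y X0 <= relent Z X0)%E]
  = [set L].
Proof.
apply/seteqP; split=> [Y [YG Y_min]|_ ->]; last first.
  split=> // Z ZG; rewrite (relent_target LG) (relent_target ZG) lee_fin.
  rewrite (kl_pythagoras ZG) lerDr.
  exact: le_trans (hellinger_ge0 _ _) (hellinger_le_kl_limit ZG).
have := Y_min L LG; rewrite (relent_target LG) (relent_target YG) lee_fin.
rewrite (kl_pythagoras YG) gerDr => kl_le0.
apply/matrixP => i j /=; apply/eqP; rewrite -subr_eq0 -sqrf_eq0.
have hell_le0 := le_trans (hellinger_le_kl_limit YG) kl_le0.
rewrite -normr_le0 ger0_norm ?sqr_ge0//.
apply: le_trans (_ : 4 * hellinger (entries Y) (entries L) <= _); last first.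
  by rewrite pmulr_rle0.
have entry_le1 S (SG : GammaSub a b X0 S) : 0 <= entries S (i, j) <= 1.
  rewrite (target_ge0 SG) -(sum_entries_target SG) le_sum_fin// => ij.
  exact: (target_ge0 SG).
exact: (sqr_sub_le_hellinger _ _ (i, j)
  (entry_le1 Y YG) (entry_le1 L LG)).
Qed.

(** The partial product is [X0 i j / X n i j], with [X n i j] tending to 0. *)
Lemma prod_ratio_infinite i j : (i, j) \in Supp X0 :\: Supp L ->
  (fun N => \prod_(0 <= n < N)
     (if odd n then colratio b (X n) j else rowratio a (X n) i))
    @ \oo --> +oo.
Proof.
rewrite !inE /= => /andP[Lij X0ij].
have L0 : L i j = 0 by apply/le_anti; rewrite (target_ge0 LG) andbT leNgt.
have X_gt0 n : 0 < X n i j by rewrite ipfp_gt0.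
have quot_oo : (fun n => X0 i j / X n i j) @ \oo --> +oo.
  apply/gtr0_cvgV0; first by near=> n; rewrite divr_gt0.
  rewrite [Z in Z @ _](_ : _ = (fun n => X n i j / X0 i j)); last first.
    by apply/funext => n; rewrite /= invf_div.
  rewrite -(mul0r (X0 i j)^-1) -L0.
  by apply: cvgM; [exact: XL|exact: cvg_cst].
suff -> : (fun N => \prod_(0 <= n < N)
    (if odd n then colratio b (X n) j else rowratio a (X n) i)) =
    (fun n => X0 i j / X n i j) by [].
by apply/funext => n; rewrite -[X0 i j](ipfp_prod n) mulrAC divff ?mul1r// gt_eqF.
Unshelve. all: by end_near. Qed.

End Limit.
End Iterates.

Theorem theorem3 (R : realType) (p q : nat) (hp : (2 <= p)%N) (hq : (2 <= q)%N)
  (a : 'rV[R]_p) (b : 'rV[R]_q)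
  (ha : forall i, 0 < a 0 i) (hb : forall j, 0 < b 0 j)
  (ha1 : \sum_(i < p) a 0 i = 1) (hb1 : \sum_(j < q) b 0 j = 1)
  (X0 : 'M[R]_(p, q)) (hX0 : Gamma1 X0)
  (hsub : exists S, Gamma a b S /\ Supp S \subset Supp X0)
  (hneq : ~ exists S, Gamma a b S /\ Supp S = Supp X0) :
  let X := ipfp a b X0 in
  [/\ forall (i : 'I_p) (j : 'I_q),
        cvgn (series (fun n => (rowratio a (X (2 * n)%N) i - 1) ^+ 2)) /\
        cvgn (series (fun n => (colratio b (X (2 * n).+1) j - 1) ^+ 2)),
      forall (i : 'I_p) (j : 'I_q),
        [/\ (fun n => Num.sqrt n%:R * (rowratio a (X n) i - 1)) @ \oo --> (0 : R),
            (fun n => Num.sqrt n%:R * (colratio b (X n) j - 1)) @ \oo --> (0 : R),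
            (fun n => rowratio a (X n) i) @ \oo --> (1 : R) &
            (fun n => colratio b (X n) j) @ \oo --> (1 : R)] &
      exists Xinf : 'M[R]_(p, q),
        [/\ X @ \oo --> Xinf,
            forall S, GammaSub a b X0 S -> Supp S \subset Supp Xinf,
            [set Y | GammaSub a b X0 Y /\
                     forall Z, GammaSub a b X0 Z ->
                       (relent Y X0 <= relent Z X0)%E] = [set Xinf] &
            forall (i : 'I_p) (j : 'I_q), (i, j) \in Supp X0 :\: Supp Xinf ->
              (fun N => \prod_(0 <= n < N)
                 (if odd n then colratio b (X n) j else rowratio a (X n) i))
                @ \oo --> +oo]].
Proof.
have [S SG] : exists S, GammaSub a b X0 S by [].
split=> [i j|i j|].
- split.
    exact: (rowratio_series_cvg ha hb ha1 hb1 hX0 SG).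
  exact: (colratio_series_cvg ha hb ha1 hb1 hX0 SG).
- have [rate_r lim_r] := rowratio_rate ha hb ha1 hb1 hX0 SG i.
  by have [rate_c lim_c] := colratio_rate ha hb ha1 hb1 hX0 SG j.
- have [L [f [f_inc XfL LG]]] := ipfp_limit_point ha hb ha1 hb1 hX0 SG.
  have [kl0 XL] :=
    ipfp_cvg_of_limit_point ha hb ha1 hb1 hX0 L f f_inc XfL LG.
  exists L; split.
  + exact: cvg_mx.
  + move=> Z ZG; apply/fintype.subsetP => -[i j]; rewrite !inE.
    exact: (limit_supp ha hb ha1 hb1 hX0 XL ZG).
  + exact: (limit_unique_minimiser ha hb ha1 hb1 hX0 LG kl0 XL).
  + exact: (prod_ratio_infinite ha hb hX0 LG XL).
Qed.
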